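(* Let $F=(f_1,\dots,f_m)^\top$ satisfy the standing assumptions (A1)–(A3). Let $\gamma_0>0$, $x_0,x_1\in\mathbb R^n$, $\gamma(t)=\mu+(\gamma_0-\mu)e^{-t}$, and let $X,Z:[0,\infty)\to\mathbb R^n$ be locally absolutely continuous with $X(0)=x_0$, $Z(0)=x_0+x_1$, satisfying for almost every $t>0$ $$X'(t)=Z(t)-X(t),\qquad \gamma(t)Z'(t)\in\mu\big(X(t)-Z(t)\big)-\operatorname*{argmin}_{v\in C(X(t))}\langle X(t)-Z(t),v\rangle.$$ Let $\alpha:=F(x_0)+\frac{\gamma_0}{2}\|x_1\|^2\mathbf 1\in\mathbb R^m$, where $\mathbf 1=(1,\dots,1)^\top$. Then $S(\alpha)<\infty$ and for all $t>0$, $$u_0(X(t))\le e^{-t}\Big[u_0(x_0)+\gamma_0\|x_0+x_1\|^2+\gamma_0S(\alpha)^2\Big].$$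
   Context: Standing assumptions: (A1) each $f_j:\mathbb R^n\to\mathbb R$ is continuously differentiable, $\nabla f_j$ is $L_j$-Lipschitz, and $f_j$ is $\mu_j$-strongly convex, i.e. $f_j(z)\ge f_j(y)+\langle\nabla f_j(y),z-y\rangle+\frac{\mu_j}{2}\|z-y\|^2$, with $0\le\mu_j\le L_j<\infty$; $\mu:=\min_j\mu_j$, $L:=\max_jL_j$. (A2) There is $j_0$ such that every sublevel set $\{x: f_{j_0}(x)\le c\}$, $c\in\mathbb R$, is bounded. (A3) For every $x\in\mathbb R^n$ there exists $x^*\in\mathcal P_w$ with $F(x^* )\le F(x)$ (componentwise). Notation: $C(x)=\mathrm{conv}\{\nabla f_j(x)\}_{j=1}^m$; $\mathcal P_w$ is the set of weakly Pareto optimal points of $\min_xF(x)$ (no $y$ with $F(y)<F(x^* )$ componentwise); $\mathcal L_F(\alpha)=\{x:F(x)\le\alpha\}$; $f(x;z)=\min_j[f_j(x)-f_j(z)]$; $u_0(x)=\sup_{z\in\mathbb R^n}f(x;z)$; $S(\alpha)=\sup_{F^*\in F(\mathcal P_w\cap\mathcal L_F(\alpha))}\inf_{z\in F^{-1}(F^* )}\|z\|$. *)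

(* Defs.v *)
From HB Require Import structures.
From mathcomp Require Import all_boot all_order all_algebra.
From mathcomp Require Import all_classical all_reals all_analysis.
Set Implicit Arguments. Unset Strict Implicit. Unset Printing Implicit Defensive.
Import Order.TTheory GRing.Theory Num.Theory.
Import numFieldNormedType.Exports.
Local Open Scope classical_set_scope.
Local Open Scope ring_scope.

Section Defs.
Variable R : realType.

Definition dotv (n : nat) (x y : 'rV[R]_n) : R := \sum_(i < n) x ord0 i * y ord0 i.
Definition enorm (n : nat) (x : 'rV[R]_n) : R := Num.sqrt (dotv x x).

Definition is_gradient (n : nat) (f : 'rV[R]_n -> R) (g : 'rV[R]_n -> 'rV[R]_n) :=
  forall x (eps : R), 0 < eps -> exists delta : R, 0 < delta /\
    forall y, enorm (y - x) < delta ->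
      `|f y - f x - dotv (g x) (y - x)| <= eps * enorm (y - x).

Definition vcontinuous (n : nat) (g : 'rV[R]_n -> 'rV[R]_n) :=
  forall x (eps : R), 0 < eps -> exists delta : R, 0 < delta /\
    forall y, enorm (y - x) < delta -> enorm (g y - g x) < eps.

Definition lipschitz_with (n : nat) (L : R) (g : 'rV[R]_n -> 'rV[R]_n) :=
  forall x y, enorm (g x - g y) <= L * enorm (x - y).

Definition strongly_convex_with (n : nat) (mu : R) (f : 'rV[R]_n -> R)
  (g : 'rV[R]_n -> 'rV[R]_n) :=
  forall y z, f y + dotv (g y) (z - y) + mu / 2 * enorm (z - y) ^+ 2 <= f z.

Definition A1 (m n : nat) (f : 'I_m -> 'rV[R]_n -> R) (g : 'I_m -> 'rV[R]_n -> 'rV[R]_n)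
  (mu L : 'I_m -> R) :=
  forall j, [/\ is_gradient (f j) (g j), vcontinuous (g j),
      lipschitz_with (L j) (g j), strongly_convex_with (mu j) (f j) (g j)
    & 0 <= mu j <= L j].

Definition A2 (m n : nat) (f : 'I_m -> 'rV[R]_n -> R) :=
  exists j0, forall c : R, exists M : R, forall x, f j0 x <= c -> enorm x <= M.

Definition weak_pareto (m n : nat) (f : 'I_m -> 'rV[R]_n -> R) (xs : 'rV[R]_n) :=
  ~ exists y, forall j, f j y < f j xs.

Definition A3 (m n : nat) (f : 'I_m -> 'rV[R]_n -> R) :=
  forall x, exists xs, weak_pareto f xs /\ forall j, f j xs <= f j x.

Definition convC (m n : nat) (g : 'I_m -> 'rV[R]_n -> 'rV[R]_n) (x : 'rV[R]_n) :
  set 'rV[R]_n :=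
  [set v | exists lam : 'I_m -> R, (forall j, 0 <= lam j) /\ \sum_j lam j = 1 /\
       v = \sum_j lam j *: g j x].

Definition argminC (m n : nat) (g : 'I_m -> 'rV[R]_n -> 'rV[R]_n) (x d : 'rV[R]_n) :
  set 'rV[R]_n :=
  [set v | convC g x v /\ forall w, convC g x w -> dotv d v <= dotv d w].

(* f(x;z) = min_j [f_j(x) - f_j(z)], computed in the extended reals
   (for m > 0 it is the finite real minimum) *)
Definition fxz (m n : nat) (f : 'I_m -> 'rV[R]_n -> R) (x z : 'rV[R]_n) : \bar R :=
  \big[Order.min/(+oo)%E]_(j < m) ((f j x - f j z)%:E).

Definition u0 (m n : nat) (f : 'I_m -> 'rV[R]_n -> R) (x : 'rV[R]_n) : \bar R :=
  ereal_sup [set fxz f x z | z in setT].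

Definition Sfun (m n : nat) (f : 'I_m -> 'rV[R]_n -> R) (alpha : 'I_m -> R) : \bar R :=
  ereal_sup [set ereal_inf [set (enorm z)%:E | z in [set z | forall j, f j z = f j xs]]
            | xs in [set xs | weak_pareto f xs /\ forall j, f j xs <= alpha j]].

Definition loc_abs_cont (n : nat) (X : R -> 'rV[R]_n) :=
  forall (T eps : R), 0 < T -> 0 < eps -> exists delta : R, 0 < delta /\
    forall (k : nat) (a b : 'I_k -> R),
      (forall i, 0 <= a i /\ a i <= b i /\ b i <= T) ->
      (forall i i', i != i' -> b i <= a i' \/ b i' <= a i) ->
      \sum_(i < k) (b i - a i) < delta ->
      \sum_(i < k) enorm (X (b i) - X (a i)) < eps.

End Defs.

(* Main.v *)
Require Import Defs.
From HB Require Import structures.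
From mathcomp Require Import all_boot all_order all_algebra.
From mathcomp Require Import all_classical all_reals all_analysis.
From mathcomp Require Import ring lra.
Set Implicit Arguments. Unset Strict Implicit. Unset Printing Implicit Defensive.
Import Order.TTheory GRing.Theory Num.Theory.
Import numFieldNormedType.Exports.
Local Open Scope classical_set_scope.
Local Open Scope ring_scope.

(* With gam(t) = mu + (gamma0 - mu) e^-t, the inclusion makes two functions decrease:
   f_j(X) + gam/2 |Z - X|^2 for each j, which keeps X in L_F(alpha), and
   e^t (f(X;z) + gam/2 |Z - z|^2) for each z. The selected v maximises <X', v> over
   C(X), so it dominates the derivative of every f_j(X), hence that of their minimum
   f(X;z); since v is a convex combination of the gradients, strong convexity bounds
   <v, z - X> by -f(X;z) - mu/2 |z - X|^2. A point z with f(X(t);z) > 0 can be replaced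
   by a weak Pareto point below it and then by a point with the same values and norm
   arbitrarily close to S(alpha).
   Monotonicity is derived from the a.e. derivative bounds without Lebesgue
   differentiation: the exceptional null set lies in an open set of small measure, on
   which absolute continuity bounds the total variation. *)

(** * Induction along a compact interval *)

(** The supremum [c] of the points where [P] holds is reached by a step from a point just left of it
    and, if [c < T], passed by a step starting at it. Hence the local step concerns pairs having [c]
    as an endpoint. *)
Lemma interval_induction (R : realType) (T : R) (P : R -> Prop) :
  0 <= T -> P 0 ->
  (forall c, 0 <= c <= T -> exists2 d : R, 0 < d &
     forall s s', 0 <= s <= T -> 0 <= s' <= T -> s <= c <= s' ->
       s' - s < d -> s = c \/ s' = c -> P s -> P s') ->
  P T.
Proof.
move=> T0 P0 step.
pose A := [set t : R | 0 <= t <= T /\ P t].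
have A0 : A 0 by split; rewrite ?lexx.
have ubA : ubound A T by move=> t [/andP[]].
have supA : has_sup A by split; [exists 0 | exists T].
pose c := sup A.
have c0 : 0 <= c by apply: ub_le_sup => //; exists T.
have cT : c <= T by apply: ge_sup => //; exists 0.
have cI : 0 <= c <= T by rewrite c0.
have [d d0 stepc] := step c cI.
have Pc : P c.
  have [s [/andP[s0 sT] Ps] sc] := sup_adherent d0 supA.
  have sc' : s <= c by apply: ub_le_sup; [exists T | split; rewrite ?s0].
  apply: (stepc s) => //; rewrite ?s0 ?sc' ?lexx //; last by right.
  by rewrite ltrBlDr addrC -ltrBlDr.
have [->//|cT'] := eqVneq T c.
have cltT : c < T by rewrite lt_neqAle cT eq_sym cT'.
pose s := Order.min T (c + d / 2).
have cs : c < s by rewrite /s lt_min cltT ltrDl divr_gt0.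
have sT : s <= T by rewrite /s ge_min lexx.
have sd : s - c < d.
  rewrite ltrBlDr; apply: (@le_lt_trans _ _ (c + d / 2)).
    by rewrite /s ge_min lexx orbT.
  by rewrite addrC ltrD2r ltr_pdivrMr // ltr_pMr // ltr1n.
have Ps : P s.
  apply: (stepc c) => //; rewrite ?lexx ?(ltW cs) ?sT ?andbT //; last by left.
  exact: le_trans c0 (ltW cs).
have : s <= c.
  by apply: ub_le_sup; [exists T | split; rewrite ?sT ?andbT ?(le_trans c0 (ltW cs))].
by rewrite leNgt cs.
Qed.

(** * Monotonicity of absolutely continuous functions *)

Section AbsolutelyContinuous.
Variable R : realType.
Implicit Types (phi : R -> R) (U : set R).
Notation mu := (@lebesgue_measure R).

Definition abs_cont_on (T : R) phi := forall eps, 0 < eps ->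
  exists2 d : R, 0 < d & forall (k : nat) (a b : 'I_k -> R),
    (forall i, 0 <= a i /\ a i <= b i /\ b i <= T) ->
    (forall i i', i != i' -> b i <= a i' \/ b i' <= a i) ->
    \sum_(i < k) (b i - a i) < d ->
    \sum_(i < k) `|phi (b i) - phi (a i)| < eps.

(** Upper derivates at most 0 on both sides of [t]. No derivative is demanded, since a minimum of
    smooth functions may have a corner. *)
Definition small_slope_at (T : R) phi (t : R) := forall eps, 0 < eps ->
  exists2 d : R, 0 < d & forall s, 0 <= s <= T -> `|s - t| < d ->
    (t <= s -> phi s - phi t <= eps * (s - t)) /\
    (s <= t -> phi t - phi s <= eps * (t - s)).

(* A chain of disjoint intervals inside the open set absorbs the increase of
   phi near the exceptional points. *)
Let chain U phi (e t : R) := exists (k : nat) (a b : nat -> R),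
  [/\ forall i, (i < k)%N -> 0 <= a i /\ a i <= b i /\ b i <= t,
      forall i i', (i < i')%N -> (i' < k)%N -> b i <= a i',
      ((\sum_(i < k) (b i - a i))%:E <= mu (U `&` `[0%R, t[))%E &
      phi t - phi 0 <= e * t + \sum_(i < k) `|phi (b i) - phi (a i)|].

(** The slope bound pays for the stretch [s, t] out of [e * (t - s)], so the same intervals
    serve. *)
Let chain_good U phi (e s t : R) : open U -> 0 <= s -> s <= t ->
  phi t - phi s <= e * (t - s) -> chain U phi e s -> chain U phi e t.
Proof.
move=> oU s0 st pts [k [a [b [h1 h2 h3 h4]]]].
exists k, a, b; split => //.
- by move=> i ik; have [? [? ?]] := h1 _ ik; do 2!split => //; exact: le_trans st.
- apply: (le_trans h3); apply: le_measure; rewrite ?inE.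
  + by apply: measurableI; [exact: measurable_realfun.open_measurable | exact: measurable_itv].
  + by apply: measurableI; [exact: measurable_realfun.open_measurable | exact: measurable_itv].
  + move=> x /= [Ux]; rewrite !in_itv /= => /andP[x0 xs]; split => //.
    by rewrite x0 (lt_le_trans xs).
- rewrite -[phi t](subrK (phi s)) -addrA.
  by apply: (le_trans (lerD pts h4)); rewrite addrA -mulrDr subrK.
Qed.

(** The stretch [s, t] is appended to the chain: it lies in [U], beyond [0, s[, so the measure grows
    by its length, and its increment becomes the new term of the sum. *)
Let chain_bad U phi (e s t : R) : open U -> 0 <= e -> 0 <= s -> s <= t ->
  `[s, t] `<=` U -> chain U phi e s -> chain U phi e t.
Proof.
move=> oU e0 s0 st stU [k [a [b [h1 h2 h3 h4]]]].
exists k.+1, (fun i => if (i < k)%N then a i else s),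
  (fun i => if (i < k)%N then b i else t).
split.
- move=> i; rewrite ltnS leq_eqVlt => /orP[/eqP ->|ik]; first by rewrite ltnn.
  by rewrite ik; have [? [? ?]] := h1 _ ik; do 2!split => //; exact: le_trans st.
- move=> i i' ii'; rewrite ltnS leq_eqVlt => /orP[/eqP ik|ik].
    by rewrite ik ltnn -ik ii'; have [] := h1 i; rewrite -?ik // => _ [].
  by rewrite ik (ltn_trans ii' ik); exact: h2.
- rewrite big_ord_recr /= ltnn.
  under eq_bigr => i _ do rewrite ltn_ord.
  have -> : U `&` `[0, t[ = (U `&` `[0, s[) `|` `[s, t[.
    apply/seteqP; split=> x /=; rewrite !in_itv /=.
      move=> [Ux /andP[x0 xt]]; rewrite x0 xt /=.
      by case: (ltP x s) => xs; [left | right].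
    move=> [[Ux /andP[-> xs]]|/andP[sx xt]]; first by rewrite (lt_le_trans xs).
    rewrite (le_trans s0) // xt; split => //.
    by apply: stU; rewrite /= in_itv /= sx ltW.
  rewrite measureU; last 3 first.
  - by apply: measurableI; [exact: measurable_realfun.open_measurable | exact: measurable_itv].
  - exact: measurable_itv.
  - rewrite -subset0 => x /= [[_]]; rewrite !in_itv /= => /andP[_ xs] /andP[sx _].
    by move: xs; rewrite ltNge sx.
  rewrite EFinD; apply: leeD => //.
  have := @lebesgue_measure_itv R `[s, t[; rewrite /= lte_fin => ->.
  by case: ifPn => [//|]; rewrite -leNgt => ts; rewrite lee_fin subr_le0.
- rewrite big_ord_recr /= ltnn.
  under eq_bigr => i _ do rewrite ltn_ord.
  have := ler_norm (phi t - phi s); have := ler_wpM2l e0 st; lra.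
Qed.

Lemma ac_nonincreasing (T : R) phi (N : set R) :
  0 < T -> abs_cont_on T phi -> mu.-negligible N ->
  (forall t, 0 < t <= T -> ~ N t -> small_slope_at T phi t) ->
  phi T <= phi 0.
Proof.
move=> T0 ac negN slope.
suff key e : 0 < e -> phi T - phi 0 <= e * T + e.
  rewrite -subr_le0; apply/ler_addgt0Pr => e e0; rewrite add0r.
  have T1 : 0 < T + 1 by rewrite addr_gt0.
  have := key (e / (T + 1)) (divr_gt0 e0 T1).
  by rewrite -[X in _ * T + X]mulr1 -mulrDr divfK // gt_eqF.
move=> e0.
have [d d0 acd] := ac e e0.
(* Slopes are controlled at positive times only, so 0 joins the exceptional set. *)
pose N0 := N `|` [set 0].
have negN0 : mu.-negligible N0.
  apply: negligibleU => //; apply/negligibleP => //.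
  exact: (@lebesgue_measure_set1 R 0).
(* A cover of measure at most [d / 2] stays strictly below the [d] that absolute continuity asks
   for. *)
have d2 : 0 < d / 2 by rewrite divr_gt0.
have [U [oU NU muU]] := outer_measure_open_le N0 d2.
move/negligible_outer_measure : negN0 => negN0.
rewrite negN0 add0e in muU.
suff [k [a [b [h1 h2 h3 h4]]]] : chain U phi e T.
  apply: (le_trans h4); rewrite lerD2l; apply/ltW.
  apply: (acd _ (fun i : 'I_k => a i) (fun i : 'I_k => b i)).
  - by move=> i; exact: h1.
  - move=> i i'; rewrite neq_ltn => /orP[] ii'; first by left; exact: h2.
    by right; exact: h2.
  - rewrite -lte_fin; apply: (le_lt_trans h3).
    apply: (@le_lt_trans _ _ (mu U)).
      apply: le_measure; rewrite ?inE; last exact: subIsetl.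
        by apply: measurableI; [exact: measurable_realfun.open_measurable | exact: measurable_itv].
      exact: measurable_realfun.open_measurable.
    apply: (le_lt_trans muU); rewrite lte_fin ltr_pdivrMr //.
    by rewrite ltr_pMr // ltr1n.
apply: interval_induction (ltW T0) _ _.
  exists 0%N, (fun=> 0), (fun=> 0); split => //.
    by rewrite big_ord0; exact: measure_ge0.
  by rewrite big_ord0 subrr mulr0 addr0.
move=> c /andP[c0 cT].
(* Around an exceptional point a whole ball lies in [U] and the stretch joins the chain; elsewhere
   the slope bound at [c] applies, on the side decided by which endpoint is [c]. *)
have [Nc|Nc] := pselect (N0 c).
  have /nbhs_ballP[r /= r0 rU] : nbhs c U by apply: open_nbhs_nbhs; split => //; exact: NU.
  exists r => // s s' /andP[s0 sT] /andP[s'0 s'T] /andP[sc cs'] ss'r _.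
  apply: chain_bad => //; [exact: ltW|exact: le_trans sc cs'|].
  move=> x /=; rewrite in_itv /= => /andP[sx xs']; apply: rU.
  rewrite /ball /= ltr_distl; apply/andP; split; lra.
have c0' : 0 < c <= T.
  rewrite cT andbT lt_neqAle c0 andbT; apply/eqP => cz; apply: Nc; right.
  by rewrite /= cz.
have [d' d'0 sl] := slope c c0' (fun h => Nc (or_introl h)) e e0.
exists d' => // s s' sI s'I /andP[sc cs'] ss'd eqc.
have s0 : 0 <= s by case/andP : sI.
apply: chain_good => //; first exact: le_trans sc cs'.
case: eqc => ec; rewrite ec in sI s'I sc cs' ss'd *.
  by apply: (sl s' _ _).1 => //; rewrite ger0_norm ?subr_ge0.
by apply: (sl s _ _).2 => //; rewrite distrC ger0_norm ?subr_ge0.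
Qed.

End AbsolutelyContinuous.

(** * Euclidean inner product *)

Section EuclideanSpace.
Variables (R : realType) (n : nat).
Implicit Types (x y z : 'rV[R]_n).

Lemma dotvC x y : dotv x y = dotv y x.
Proof. by apply: eq_bigr => i _; rewrite mulrC. Qed.

Lemma dotvDl x y z : dotv (x + y) z = dotv x z + dotv y z.
Proof.
by rewrite /dotv -big_split /=; apply: eq_bigr => i _; rewrite mxE mulrDl.
Qed.

Lemma dotvZl (a : R) x y : dotv (a *: x) y = a * dotv x y.
Proof. by rewrite /dotv mulr_sumr; apply: eq_bigr => i _; rewrite mxE mulrA. Qed.

Lemma dotvNl x y : dotv (- x) y = - dotv x y.
Proof. by rewrite -scaleN1r dotvZl mulN1r. Qed.

Lemma dotvBl x y z : dotv (x - y) z = dotv x z - dotv y z.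
Proof. by rewrite dotvDl dotvNl. Qed.

Lemma dotvDr x y z : dotv z (x + y) = dotv z x + dotv z y.
Proof. by rewrite dotvC dotvDl !(dotvC z). Qed.

Lemma dotvZr (a : R) x y : dotv y (a *: x) = a * dotv y x.
Proof. by rewrite dotvC dotvZl dotvC. Qed.

Lemma dotvNr x y : dotv y (- x) = - dotv y x.
Proof. by rewrite dotvC dotvNl dotvC. Qed.

Definition dotvE := (dotvDl, dotvNl, dotvDr, dotvNr, dotvZl, dotvZr).

Lemma dotv_ge0 x : 0 <= dotv x x.
Proof. by apply: sumr_ge0 => i _; rewrite -expr2 sqr_ge0. Qed.

Lemma enorm_ge0 x : 0 <= enorm x.
Proof. exact: sqrtr_ge0. Qed.

Lemma enorm_sqr x : enorm x ^+ 2 = dotv x x.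
Proof. by rewrite sqr_sqrtr // dotv_ge0. Qed.

Lemma enormN x : enorm (- x) = enorm x.
Proof. by rewrite /enorm !dotvE opprK. Qed.

Lemma enormB x y : enorm (x - y) = enorm (y - x).
Proof. by rewrite -enormN opprB. Qed.

(** Cauchy-Schwarz, from |a x - y|^2 >= 0 at the minimising a = <x,y> / <x,x>. *)
Lemma dotv_le x y : dotv x y <= enorm x * enorm y.
Proof.
have key (a : R) : 0 <= dotv x x * a ^+ 2 - 2 * a * dotv x y + dotv y y.
  have := dotv_ge0 (a *: x - y); rewrite !dotvE (dotvC y x) => h.
  apply: (le_trans h); rewrite le_eqVlt; apply/orP; left; apply/eqP; ring.
have [xy0|xy0] := ltP (dotv x y) 0.
  by apply: (le_trans (ltW xy0)); rewrite mulr_ge0 // enorm_ge0.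
rewrite -(@ler_pXn2r _ 2) // ?nnegrE ?mulr_ge0 ?enorm_ge0 //.
rewrite exprMn !enorm_sqr.
have [x0|x0] := eqVneq (dotv x x) 0.
  rewrite x0 mul0r; suff -> : dotv x y = 0 by rewrite expr0n.
  (* When <x,x> = 0 the quadratic is affine in [a]; this value makes it -1 unless <x,y> = 0. *)
  have := key ((dotv y y + 1) / (2 * dotv x y)); rewrite x0.
  have [->//|nz] := eqVneq (dotv x y) 0.
  rewrite mul0r sub0r.
  have -> : 2 * ((dotv y y + 1) / (2 * dotv x y)) * dotv x y = dotv y y + 1.
    by field.
  by move=> h; exfalso; lra.
have xp : 0 < dotv x x by rewrite lt_neqAle eq_sym x0 dotv_ge0.
have := key (dotv x y / dotv x x).
have -> : dotv x x * (dotv x y / dotv x x) ^+ 2 -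
  2 * (dotv x y / dotv x x) * dotv x y + dotv y y =
  (dotv x x * dotv y y - dotv x y ^+ 2) / dotv x x by field.
by rewrite pmulr_lge0 ?invr_gt0 // subr_ge0.
Qed.

Lemma dotv_abs x y : `|dotv x y| <= enorm x * enorm y.
Proof.
rewrite ler_norml dotv_le andbT lerNl -dotvNl.
by apply: (le_trans (dotv_le _ _)); rewrite enormN.
Qed.

Lemma enormD x y : enorm (x + y) <= enorm x + enorm y.
Proof.
rewrite -(@ler_pXn2r _ 2) // ?nnegrE ?addr_ge0 ?enorm_ge0 //.
rewrite sqrrD !enorm_sqr !dotvE (dotvC y x).
have := dotv_le x y; lra.
Qed.

Lemma coord_le_enorm x i : `|x ord0 i| <= enorm x.
Proof.
rewrite -(@ler_pXn2r _ 2) // ?nnegrE ?normr_ge0 ?enorm_ge0 //.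
rewrite enorm_sqr real_normK ?num_real // /dotv (bigD1 i) //= -expr2 lerDl.
by apply: sumr_ge0 => j _; rewrite -expr2 sqr_ge0.
Qed.

(** The parallelogram law without |x + y|^2. It turns the factor gamma0 / 2 of the Lyapunov function
    into the gamma0 of the final bound. *)
Lemma enormB_sqr_le x y : enorm (x - y) ^+ 2 <= 2 * enorm x ^+ 2 + 2 * enorm y ^+ 2.
Proof.
rewrite !enorm_sqr !dotvE (dotvC y x).
have := dotv_ge0 (x + y); rewrite !dotvE (dotvC y x); lra.
Qed.

End EuclideanSpace.

(** * Absolute continuity along the trajectory *)

Section LipschitzModulus.
Variables (R : realType) (T : R) (w : R -> R -> R).
Hypothesis w0 : forall a b, a <= b -> 0 <= w a b.

(** Increments are measured against one modulus [w], and boundedness is included so that the class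
    is closed under products. Absolute continuity then has to be checked for [w] alone. *)
Definition lip_wrt (phi : R -> R) := exists K : R, [/\ 0 <= K,
  forall t, 0 <= t <= T -> `|phi t| <= K &
  forall a b, 0 <= a -> a <= b -> b <= T -> `|phi b - phi a| <= K * w a b].

Lemma lip_wrt_cst c : lip_wrt (fun=> c).
Proof.
exists `|c|; split => // a b _ ab _.
by rewrite subrr normr0 mulr_ge0 ?w0.
Qed.

Lemma lip_wrtD phi psi : lip_wrt phi -> lip_wrt psi ->
  lip_wrt (fun t => phi t + psi t).
Proof.
move=> [K [K0 pK pL]] [K' [K'0 qK qL]]; exists (K + K'); split.
- exact: addr_ge0.
- by move=> t tT; apply: (le_trans (ler_normD _ _)); rewrite lerD ?pK ?qK.
- move=> a b a0 ab bT; rewrite opprD addrACA mulrDl.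
  by apply: (le_trans (ler_normD _ _)); rewrite lerD ?pL ?qL.
Qed.

Lemma lip_wrtM phi psi : lip_wrt phi -> lip_wrt psi ->
  lip_wrt (fun t => phi t * psi t).
Proof.
move=> [K [K0 pK pL]] [K' [K'0 qK qL]]; exists (K * K' + K * K'); split.
- by rewrite addr_ge0 // mulr_ge0.
- move=> t tT; rewrite normrM.
  apply: (@le_trans _ _ (K * K')); last by rewrite lerDl mulr_ge0.
  by rewrite ler_pM ?pK ?qK.
- move=> a b a0 ab bT.
  have -> : phi b * psi b - phi a * psi a =
    phi b * (psi b - psi a) + (phi b - phi a) * psi a by ring.
  apply: (le_trans (ler_normD _ _)); rewrite !normrM mulrDl.
  have bI : 0 <= b <= T by rewrite (le_trans a0 ab).
  have aI : 0 <= a <= T by rewrite a0 (le_trans ab bT).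
  apply: lerD; first by rewrite -mulrA ler_pM ?pK ?qL.
  by rewrite mulrAC ler_pM ?pL ?qK.
Qed.

Lemma lip_wrt_sum k (phi : 'I_k -> R -> R) : (forall i, lip_wrt (phi i)) ->
  lip_wrt (fun t => \sum_(i < k) phi i t).
Proof.
elim: k phi => [|k IH] phi h.
  have -> : (fun t => \sum_(i < 0) phi i t) = fun=> 0.
    by apply/funext => t; rewrite big_ord0.
  exact: lip_wrt_cst.
have -> : (fun t => \sum_(i < k.+1) phi i t) =
    fun t => \sum_(i < k) phi (widen_ord (leqnSn k) i) t + phi ord_max t.
  by apply/funext => t; rewrite big_ord_recr.
by apply: lip_wrtD; [apply: IH => i; exact: h | exact: h].
Qed.

(** A piece attaining the minimum at one endpoint lies above it at the other, so its increment
    bounds that of [h] in one direction; exchanging the endpoints gives the other. *)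
Lemma lip_wrt_min k (phi : 'I_k -> R -> R) (h : R -> R) :
  (forall i, lip_wrt (phi i)) -> (forall i t, h t <= phi i t) ->
  (forall t, exists i, h t = phi i t) -> lip_wrt h.
Proof.
move=> lphi hle hex.
have /(fin_all_exists) [K hK] := lphi.
have K0 i : 0 <= K i by have [] := hK i.
have Kle i : K i <= \sum_i K i by rewrite (bigD1 i) //= lerDl sumr_ge0.
exists (\sum_i K i); split.
- exact: sumr_ge0.
- move=> t tT; have [i ->] := hex t; apply: le_trans (Kle i).
  by have [_ + _] := hK i; exact.
- move=> a b a0 ab bT.
  have step i : `|phi i b - phi i a| <= (\sum_i K i) * w a b.
    apply: (@le_trans _ _ (K i * w a b)); last by rewrite ler_wpM2r ?w0.
    by have [_ _] := hK i; exact.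
  rewrite ler_norml; apply/andP; split.
    have [i hi] := hex b; rewrite hi.
    have := hle i a; have := step i; rewrite ler_norml => /andP[]; lra.
  have [i hi] := hex a; rewrite hi.
  have := hle i b; have := step i; rewrite ler_norml => /andP[]; lra.
Qed.

Hypothesis w_ac : forall eps, 0 < eps ->
  exists2 d : R, 0 < d & forall (k : nat) (a b : 'I_k -> R),
    (forall i, 0 <= a i /\ a i <= b i /\ b i <= T) ->
    (forall i i', i != i' -> b i <= a i' \/ b i' <= a i) ->
    \sum_(i < k) (b i - a i) < d ->
    \sum_(i < k) w (a i) (b i) < eps.

Lemma lip_wrt_abs_cont phi : lip_wrt phi -> abs_cont_on T phi.
Proof.
move=> [K [K0 _ pL]] e e0.
(* [K] may be 0, so [eps] is divided by [K + 1]. *)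
have K1 : 0 < K + 1 by rewrite ltr_wpDl.
have [d d0 hd] := w_ac (divr_gt0 e0 K1).
exists d => // k a b h1 h2 h3.
have := hd k a b h1 h2 h3; rewrite ltr_pdivlMr // => /(le_lt_trans _); apply.
rewrite mulr_suml; apply: ler_sum => i _.
have [? [? ?]] := h1 i.
by apply: (le_trans (pL _ _ _ _ _)) => //; rewrite mulrC ler_wpM2l ?w0 // lerDl.
Qed.

End LipschitzModulus.

Section TrajectoryModulus.
Variables (R : realType) (n : nat) (X Z : R -> 'rV[R]_n).
Hypothesis (hX : loc_abs_cont X) (hZ : loc_abs_cont Z).
Variable T : R.
Hypothesis T0 : 0 < T.

(** Over a stretch shorter than the [d] belonging to eps = 1 the path moves by less than 1, so each
    stretch raises the bound by one unit; interval induction joins the stretches. *)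
Lemma loc_abs_cont_bounded (Y : R -> 'rV[R]_n) : loc_abs_cont Y ->
  exists2 M : R, 0 <= M & forall t, 0 <= t <= T -> enorm (Y t) <= M.
Proof.
move=> hY.
have [d [d0 hd]] := hY T 1 T0 ltr01.
have step a b : 0 <= a -> a <= b -> b <= T -> b - a < d -> enorm (Y b - Y a) < 1.
  move=> a0 ab bT bad.
  have := hd 1%N (fun=> a) (fun=> b); rewrite !big_ord1; apply => //.
  by move=> i i'; rewrite !ord1.
pose P c := exists2 M : R, 0 <= M & forall t, 0 <= t <= c -> enorm (Y t) <= M.
suff : P T by [].
apply: interval_induction (ltW T0) _ _.
  exists (enorm (Y 0)); first exact: enorm_ge0.
  by move=> t t0; have -> : t = 0 by apply/eqP; rewrite eq_le andbC.
move=> c cI; exists d => // s s' /andP[s0 sT] /andP[s'0 s'T] /andP[sc cs'] ss' _ [M M0 hM].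
exists (M + 1); first by rewrite addr_ge0.
move=> t /andP[t0 ts'].
have [ts|/ltW st] := leP t s; first by apply: (le_trans (hM t _)); rewrite ?t0 ?lerDl.
rewrite -[Y t](subrK (Y s)) addrC; apply: (le_trans (enormD _ _)).
apply: lerD; first by rewrite hM // s0 lexx.
by apply/ltW/step => //; [exact: le_trans ts' s'T | lra].
Qed.

(** One modulus for everything built from [X], [Z] and time; the term [b - a] admits Lipschitz
    functions of [t] such as the exponentials. *)
Definition path_modulus (a b : R) :=
  enorm (X b - X a) + enorm (Z b - Z a) + (b - a).

Lemma path_modulus_ge0 a b : a <= b -> 0 <= path_modulus a b.
Proof. by move=> ab; rewrite addr_ge0 ?subr_ge0 // addr_ge0 ?enorm_ge0. Qed.

Lemma path_modulus_ac eps : 0 < eps ->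
  exists2 d : R, 0 < d & forall (k : nat) (a b : 'I_k -> R),
    (forall i, 0 <= a i /\ a i <= b i /\ b i <= T) ->
    (forall i i', i != i' -> b i <= a i' \/ b i' <= a i) ->
    \sum_(i < k) (b i - a i) < d ->
    \sum_(i < k) path_modulus (a i) (b i) < eps.
Proof.
move=> e0; have e3 : 0 < eps / 3 by rewrite divr_gt0.
have [d1 [d10 h1]] := hX T0 e3.
have [d2 [d20 h2]] := hZ T0 e3.
exists (Num.min (eps / 3) (Num.min d1 d2)).
  by rewrite !lt_min e3 d10.
move=> k a b ha hb; rewrite !lt_min => /andP[s3 /andP[s1 s2]].
rewrite /path_modulus !big_split /= -/(path_modulus _ _).
have := h1 k a b ha hb s1; have := h2 k a b ha hb s2.
move: s3; rewrite big_split /=; lra.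
Qed.

Notation lip := (lip_wrt T path_modulus).

Lemma lip_wrt_coord (Y : R -> 'rV[R]_n) i : loc_abs_cont Y ->
  (forall a b, a <= b -> enorm (Y b - Y a) <= path_modulus a b) ->
  lip (fun t => Y t ord0 i).
Proof.
move=> hY YL; have [M M0 hM] := loc_abs_cont_bounded hY.
(* [M] bounds the values, and the added 1 covers the increment bound with factor 1. *)
exists (M + 1); split; first by rewrite addr_ge0.
  move=> t tI; apply: (le_trans (coord_le_enorm _ _)).
  by apply: (le_trans (hM t tI)); rewrite lerDl.
move=> a b a0 ab bT.
have -> : Y b ord0 i - Y a ord0 i = (Y b - Y a) ord0 i by rewrite !mxE.
apply: (le_trans (coord_le_enorm _ _)); apply: (le_trans (YL _ _ ab)).
by rewrite ler_peMl ?path_modulus_ge0 // lerDr.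
Qed.

Lemma lip_wrt_X i : lip (fun t => X t ord0 i).
Proof.
apply: lip_wrt_coord => // a b ab.
by rewrite /path_modulus -addrA lerDl addr_ge0 ?enorm_ge0 ?subr_ge0.
Qed.

Lemma lip_wrt_Z i : lip (fun t => Z t ord0 i).
Proof.
apply: lip_wrt_coord => // a b ab.
rewrite /path_modulus; have := enorm_ge0 (X b - X a); lra.
Qed.

Lemma lip_wrt_dotv (Y W : R -> 'rV[R]_n) :
  (forall i, lip (fun t => Y t ord0 i)) -> (forall i, lip (fun t => W t ord0 i)) ->
  lip (fun t => dotv (Y t) (W t)).
Proof.
move=> hY hW; apply: lip_wrt_sum => [|i]; first exact: path_modulus_ge0.
exact: lip_wrtM.
Qed.

Lemma lip_wrt_of_lipschitz (phi : R -> R) (K : R) : 0 <= K ->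
  (forall t, 0 <= t <= T -> `|phi t| <= K) ->
  (forall a b, 0 <= a -> a <= b -> b <= T -> `|phi b - phi a| <= K * (b - a)) ->
  lip phi.
Proof.
move=> K0 pK pL; exists K; split => // a b a0 ab bT.
apply: (le_trans (pL _ _ a0 ab bT)); apply: ler_wpM2l => //.
by rewrite lerDr addr_ge0 // enorm_ge0.
Qed.

(** The increment bound is [1 + x <= exp x] at [x = a - b], multiplied by [exp b]. *)
Lemma lip_wrt_expR : lip expR.
Proof.
apply: (@lip_wrt_of_lipschitz _ (expR T)); first exact: expR_ge0.
  by move=> t /andP[t0 tT]; rewrite ger0_norm ?expR_ge0 // ler_expR.
move=> a b a0 ab bT.
rewrite ger0_norm ?subr_ge0 ?ler_expR //.
have -> : expR a = expR b * expR (a - b) by rewrite -expRD addrC subrK.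
apply: (@le_trans _ _ (expR b * (b - a))).
  have := expR_ge1Dx (a - b).
  move=> /(ler_wpM2l (expR_ge0 b)); lra.
by rewrite ler_wpM2r ?subr_ge0 // ler_expR.
Qed.

Lemma lip_wrt_expRN : lip (fun t => expR (- t)).
Proof.
apply: (@lip_wrt_of_lipschitz _ 1) => //.
  move=> t /andP[t0 tT]; rewrite ger0_norm ?expR_ge0 //.
  by rewrite -expR0 ler_expR oppr_le0.
move=> a b a0 ab bT; rewrite mul1r distrC.
rewrite ger0_norm ?subr_ge0 ?ler_expR ?lerN2 //.
have -> : expR (- b) = expR (- a) * expR (a - b) by rewrite -expRD addKr.
have := expR_ge1Dx (a - b) => /(ler_wpM2l (expR_ge0 (- a))).
have : expR (- a) * (b - a) <= b - a.
  by rewrite ler_piMl ?subr_ge0 // -expR0 ler_expR oppr_le0.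
lra.
Qed.

(** The gradient is bounded by some [G] along the bounded path, and the subgradient inequality at
    both endpoints bounds |f (X b) - f (X a)| by [G] times |X b - X a|. *)
Lemma lip_wrt_convex (f : 'rV[R]_n -> R) (g : 'rV[R]_n -> 'rV[R]_n) (L : R) :
  0 <= L -> lipschitz_with L g ->
  (forall y z, f y + dotv (g y) (z - y) <= f z) ->
  lip (fun t => f (X t)).
Proof.
move=> L0 gL fcvx; have [M M0 hM] := loc_abs_cont_bounded hX.
pose G := enorm (g 0) + L * M.
have G0 : 0 <= G by rewrite addr_ge0 ?enorm_ge0 ?mulr_ge0.
have gG t : 0 <= t <= T -> enorm (g (X t)) <= G.
  move=> tI; rewrite -[g (X t)](subrK (g 0)) addrC.
  apply: (le_trans (enormD _ _)); rewrite lerD2l.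
  apply: (le_trans (gL _ _)); rewrite subr0 ler_wpM2l //; exact: hM.
have fL s t : 0 <= s <= T -> 0 <= t <= T ->
    f (X s) - f (X t) <= G * enorm (X t - X s).
  move=> sI tI; have := fcvx (X s) (X t).
  have := dotv_abs (g (X s)) (X t - X s); rewrite ler_norml => /andP[+ _].
  have := ler_wpM2r (enorm_ge0 (X t - X s)) (gG s sI); lra.
have zI : 0 <= (0 : R) <= T by rewrite lexx ltW.
pose K := `|f (X 0)| + G * (M + M).
have K0 : 0 <= K by rewrite addr_ge0 // mulr_ge0 // addr_ge0.
exists (G + K); split; first by rewrite addr_ge0.
  move=> t tI.
  have dX : enorm (X t - X 0) <= M + M.
    by apply: (le_trans (enormD _ _)); rewrite enormN lerD ?hM.
  have h1 := fL t 0 tI zI; have h2 := fL 0 t zI tI.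
  rewrite enormB in h1.
  have h3 := ler_wpM2l G0 dX.
  have := ler_norm (f (X 0)); have := ler_norm (- f (X 0)); rewrite normrN => n1 n2.
  rewrite ler_norml /K; apply/andP; split; lra.
move=> a b a0 ab bT.
have aI : 0 <= a <= T by rewrite a0 (le_trans ab).
have bI : 0 <= b <= T by rewrite (le_trans a0).
apply: (@le_trans _ _ (G * enorm (X b - X a))).
  have h1 := fL b a bI aI; have h2 := fL a b aI bI.
  rewrite enormB in h1.
  rewrite ler_norml; apply/andP; split; lra.
apply: ler_pM => //; rewrite ?enorm_ge0 ?lerDl //.
by rewrite /path_modulus -addrA lerDl addr_ge0 ?enorm_ge0 ?subr_ge0.
Qed.

Lemma lip_wrt_path_abs_cont phi : lip phi -> abs_cont_on T phi.
Proof.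
by apply: lip_wrt_abs_cont; [exact: path_modulus_ge0 | exact: path_modulus_ac].
Qed.

End TrajectoryModulus.

(** * Derivatives and one-sided slopes *)

(** A quotient-free form, from which squeezing and one-sided slopes can be read off. *)
Lemma is_derive1P (R : realType) (phi : R -> R) (t d : R) :
  is_derive t 1 phi d <-> forall eps, 0 < eps -> exists2 r : R, 0 < r &
    forall s, `|s - t| < r -> `|phi s - phi t - d * (s - t)| <= eps * `|s - t|.
Proof.
split.
  move=> [dphi dE] eps e0; rewrite /derivable in dphi.
  have : h^-1 *: ((phi \o shift t) (h *: (1:R)) - phi t) @[h --> 0^'] --> d.
    by rewrite -dE; exact: dphi.
  move=> /cvgrPdist_lt /(_ _ e0) -[r /= r0 hr].
  exists r => // s sr.
  have [->|st] := eqVneq s t; first by rewrite !subrr mulr0 subrr normr0 mulr0.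
  have st0 : s - t != 0 by rewrite subr_eq0.
  have := hr (s - t); rewrite /= sub0r normrN => /(_ sr st0).
  rewrite /shift /= scaler1 subrK /GRing.scale /= => h.
  have -> : phi s - phi t - d * (s - t) =
      - (d - (s - t)^-1 * (phi s - phi t)) * (s - t).
    by rewrite opprB mulrBl mulrAC mulVf // mul1r.
  by rewrite normrM normrN ler_wpM2r // ltW.
move=> hd.
have lim : h^-1 *: ((phi \o shift t) (h *: (1:R)) - phi t) @[h --> 0^'] --> d.
  apply/cvgrPdist_le => e e0.
  have [r r0 hr] := hd e e0.
  exists r => //= h; rewrite /ball /= sub0r normrN => hr' h0.
  have := hr (h + t); rewrite addrK => /(_ hr').
  rewrite /shift /= scaler1 /GRing.scale /= => hh.
  have -> : d - h^-1 * (phi (h + t) - phi t) = - h^-1 * (phi (h + t) - phi t - d * h).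
    by field.
  rewrite normrM normrN normfV mulrC ler_pdivrMr ?normr_gt0 //.
split; first by apply/cvg_ex; exists d.
exact: cvg_lim lim.
Qed.

Lemma is_derive1_squeeze0 (R : realType) (rho q : R -> R) (t : R) :
  (forall s, `|rho s| <= q s) -> q t = 0 -> is_derive t 1 q 0 ->
  is_derive t 1 rho 0.
Proof.
move=> hle qt /is_derive1P hq; apply/is_derive1P => e e0.
have [r r0 hr] := hq e e0; exists r => // s sr.
have rt : rho t = 0.
  by apply/eqP; rewrite -normr_le0; apply: (le_trans (hle t)); rewrite qt.
have := hr s sr; rewrite rt qt !mul0r !subr0; apply: le_trans.
exact: le_trans (hle s) (ler_norm _).
Qed.

Lemma is_derive_small_slope (R : realType) (T : R) (phi : R -> R) (t d : R) :
  is_derive t 1 phi d -> d <= 0 -> small_slope_at T phi t.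
Proof.
move=> /is_derive1P hphi d0 e e0.
have [r r0 hr] := hphi e e0; exists r => // s _ sr.
have := hr s sr; rewrite ler_norml => /andP[h1 h2]; split => st.
- have := mulr_le0_ge0 d0 (_ : 0 <= s - t); rewrite subr_ge0 => /(_ st).
  move: h2; rewrite ger0_norm ?subr_ge0 //; lra.
- have := mulr_le0_ge0 d0 (_ : 0 <= t - s); rewrite subr_ge0 => /(_ st).
  move: h1; rewrite distrC ger0_norm ?subr_ge0 //; lra.
Qed.

(* Suited to a minimum of smooth functions: going right the increment is
   bounded by that of a piece active at t, going left by that of a piece active at s. *)
Lemma small_slope_family (R : realType) (T : R) (phi : R -> R) (t : R)
    (k : nat) (B : 'I_k -> R -> R) :
  (forall j, small_slope_at T (B j) t) ->
  (forall s, exists j, phi s - phi t <= B j s - B j t) ->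
  (forall s, exists j, phi t - phi s <= B j t - B j s) ->
  small_slope_at T phi t.
Proof.
move=> hB hr hl e e0.
have /fin_all_exists2 [d d0 hd] : forall j, exists2 d : R, 0 < d &
    forall s, 0 <= s <= T -> `|s - t| < d ->
    (t <= s -> B j s - B j t <= e * (s - t)) /\
    (s <= t -> B j t - B j s <= e * (t - s)) by move=> j; exact: hB.
exists (\big[Num.min/1]_j d j); first by apply: lt_bigmin => // j _; exact: d0.
move=> s sI sd; split => st.
- have [j hj] := hr s; apply: (le_trans hj).
  by apply: (hd j s sI _).1 => //; apply: (lt_le_trans sd); exact: bigmin_le.
- have [j hj] := hl s; apply: (le_trans hj).
  by apply: (hd j s sI _).2 => //; apply: (lt_le_trans sd); exact: bigmin_le.
Qed.

Section VectorDerivatives.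
Variables (R : realType) (n : nat).

(** Taken coordinatewise so that the scalar sum and product rules apply to [dotv]. *)
Definition coord_derive (Y : R -> 'rV[R]_n) (t : R) (Y' : 'rV[R]_n) :=
  forall i, is_derive t 1 (fun s => Y s ord0 i) (Y' ord0 i).

Lemma derivable_coord_derive (Y : R -> 'rV[R]_n) t :
  derivable Y t 1 -> coord_derive Y t ('D_1 Y t).
Proof.
move=> dY i; split; first by have /derivable_mxP := dY; exact.
by rewrite derive_mx // mxE.
Qed.

Lemma coord_derive_cst (c : 'rV[R]_n) t : coord_derive (fun=> c) t 0.
Proof. by move=> i; rewrite mxE; exact: is_derive_cst. Qed.

Lemma coord_deriveB (Y W : R -> 'rV[R]_n) t Y' W' :
  coord_derive Y t Y' -> coord_derive W t W' ->
  coord_derive (fun s => Y s - W s) t (Y' - W').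
Proof.
move=> hY hW i; rewrite !mxE.
have -> : (fun s => (Y s - W s) ord0 i) =
   (fun s => Y s ord0 i) - (fun s => W s ord0 i).
  by apply/funext => s; rewrite !mxE.
exact: is_deriveB.
Qed.

Lemma is_derive_dotv (Y W : R -> 'rV[R]_n) t Y' W' :
  coord_derive Y t Y' -> coord_derive W t W' ->
  is_derive t 1 (fun s => dotv (Y s) (W s)) (dotv Y' (W t) + dotv (Y t) W').
Proof.
move=> hY hW.
have -> : (fun s => dotv (Y s) (W s)) =
    \sum_(i < n) ((fun s => Y s ord0 i) * (fun s => W s ord0 i)).
  by apply/funext => s; rewrite fct_sumE.
apply: is_derive_eq.
  by apply: is_derive_sum => i; apply: is_deriveM; [exact: hY | exact: hW].
rewrite /dotv -big_split /=; apply: eq_bigr => i _.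
by rewrite addrC; congr (_ + _); exact: mulrC.
Qed.

(* The subgradient inequality at both endpoints gives
   |f (Y s) - f (Y t) - <g (Y t), Y s - Y t>| <= L |Y s - Y t|^2. *)
Lemma is_derive_convex (f : 'rV[R]_n -> R) (g : 'rV[R]_n -> 'rV[R]_n) (L : R)
    (Y : R -> 'rV[R]_n) t Y' :
  lipschitz_with L g -> (forall y z, f y + dotv (g y) (z - y) <= f z) ->
  coord_derive Y t Y' -> is_derive t 1 (fun s => f (Y s)) (dotv (g (Y t)) Y').
Proof.
move=> gL fcvx hY.
pose D s := Y s - Y t.
have hD : coord_derive D t Y'.
  rewrite -[Y']subr0; apply: coord_deriveB => //; exact: coord_derive_cst.
have Dt : D t = 0 by rewrite /D subrr.
pose lin s := dotv (g (Y t)) (D s).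
pose rho s := f (Y s) - f (Y t) - lin s.
have hlin : is_derive t 1 lin (dotv (g (Y t)) Y').
  apply: is_derive_eq; first exact: is_derive_dotv (coord_derive_cst _ _) hD.
  by rewrite -(scale0r (g (Y t))) dotvZl mul0r add0r.
have hrho : is_derive t 1 rho 0.
  apply: (@is_derive1_squeeze0 _ _ (fun s => L * dotv (D s) (D s))).
  - move=> s; rewrite -enorm_sqr.
    have := fcvx (Y t) (Y s); have := fcvx (Y s) (Y t).
    rewrite -[Y t - Y s]opprB dotvNr -/(D s) => h1 h2.
    have : dotv (g (Y s)) (D s) - dotv (g (Y t)) (D s) <= L * enorm (D s) ^+ 2.
      rewrite -dotvBl; apply: (le_trans (dotv_le _ _)).
      by rewrite expr2 mulrA ler_wpM2r ?enorm_ge0 //; exact: gL.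
    by rewrite /rho /lin ler_norml => h3; apply/andP; split; lra.
  - by rewrite Dt -(scale0r (D t)) dotvZl mul0r mulr0.
  - have -> : (fun s => L * dotv (D s) (D s)) = L \*: (fun s => dotv (D s) (D s)).
      by apply/funext => s.
    apply: is_derive_eq; first exact: (is_deriveZ L (is_derive_dotv hD hD)).
    by rewrite Dt -(scale0r (D t)) dotvZl dotvZr !mul0r addr0 scaler0.
have hsum := is_deriveD (is_derive_cst (f (Y t)) t 1) (is_deriveD hrho hlin).
have -> : (fun s => f (Y s)) = (cst (f (Y t)) : R -> R) + (rho + lin).
  by apply/funext => s; rewrite /rho /= !fctE; ring.
by apply: (is_derive_eq hsum); rewrite !add0r.
Qed.

End VectorDerivatives.

Lemma is_derive1D (R : realType) (phi psi : R -> R) (t a b : R) :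
  is_derive t 1 phi a -> is_derive t 1 psi b ->
  is_derive t 1 (fun s => phi s + psi s) (a + b).
Proof. exact: is_deriveD. Qed.

Lemma is_derive1M (R : realType) (phi psi : R -> R) (t a b : R) :
  is_derive t 1 phi a -> is_derive t 1 psi b ->
  is_derive t 1 (fun s => phi s * psi s) (phi t * b + psi t * a).
Proof. exact: is_deriveM. Qed.

(** * Decreasing functions of the flow *)

Section MinGap.
Variables (R : realType) (m n : nat) (f : 'I_m -> 'rV[R]_n -> R).
Hypothesis hm : (0 < m)%N.

(** The real value of f(x;z); [fine] loses nothing because [m] is positive. *)
Definition gap x z : R := fine (fxz f x z).

Let fxz_attained x z : exists j, fxz f x z = (f j x - f j z)%:E.
Proof.
rewrite /fxz.
have [j _ ->] := @eq_bigmin _ _ _ +oo%E (Ordinal hm) xpredT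
  (fun j => (f j x - f j z)%:E) isT (fun j _ => leey _).
by exists j.
Qed.

Lemma gapE x z : fxz f x z = (gap x z)%:E.
Proof. by rewrite /gap; have [j ->] := fxz_attained x z. Qed.

Lemma gap_le x z j : gap x z <= f j x - f j z.
Proof. by rewrite -lee_fin -gapE; exact: bigmin_le. Qed.

Lemma gap_attained x z : exists j, gap x z = f j x - f j z.
Proof.
by have [j hj] := fxz_attained x z; exists j; rewrite /gap hj.
Qed.

End MinGap.

Section Flow.
Variables (R : realType) (m n : nat).
Variables (f : 'I_m -> 'rV[R]_n -> R) (g : 'I_m -> 'rV[R]_n -> 'rV[R]_n).
Variables (Lj : 'I_m -> R) (mu gamma0 : R) (X Z : R -> 'rV[R]_n) (N : set R).
Hypothesis hm : (0 < m)%N.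
Hypothesis mu0 : 0 <= mu.
Hypothesis gamma0_gt0 : 0 < gamma0.
Hypothesis Lj0 : forall j, 0 <= Lj j.
Hypothesis gL : forall j, lipschitz_with (Lj j) (g j).
Hypothesis fsc : forall j, strongly_convex_with mu (f j) (g j).
Hypothesis (hXac : loc_abs_cont X) (hZac : loc_abs_cont Z).
Hypothesis negN : (@lebesgue_measure R).-negligible N.

Let gam (t : R) := mu + (gamma0 - mu) * expR (- t).

Hypothesis hode : forall t : R, 0 < t -> ~ N t ->
  [/\ derivable X t 1, derivable Z t 1, 'D_1 X t = Z t - X t
    & exists v, argminC g (X t) (X t - Z t) v /\
       gam t *: 'D_1 Z t = mu *: (X t - Z t) - v].

Let fcvx j y z : f j y + dotv (g j y) (z - y) <= f j z.
Proof.
apply: le_trans (fsc j y z); rewrite lerDl.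
by rewrite mulr_ge0 ?sqr_ge0 // divr_ge0.
Qed.

(** [gam t] is a convex combination of mu >= 0 and gamma0 > 0, with positive weight e^-t on
    gamma0. *)
Let gam_gt0 t : 0 < t -> 0 < gam t.
Proof.
move=> t0; have e1 : expR (- t) <= 1 by rewrite -expR0 ler_expR oppr_le0 ltW.
have e0 := expR_gt0 (- t).
have -> : gam t = mu * (1 - expR (- t)) + gamma0 * expR (- t) by rewrite /gam; ring.
by rewrite ltr_wpDl ?mulr_gt0 // mulr_ge0 // subr_ge0.
Qed.

(** In [lyapunov_decrease] the part [- gam t] cancels what the factor e^t contributes through [q],
    and [mu] meets the quadratic term of strong convexity. *)
Let is_derive_gam (t : R) : is_derive t 1 gam (mu - gam t).
Proof.
have dN : is_derive t 1 (fun s : R => - s) (-1) by exact: is_deriveNid.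
have de := is_derive1_comp (is_derive_expR (- t)) dN.
have := is_derive1D (is_derive_cst mu t 1)
  (is_derive1M (is_derive_cst (gamma0 - mu) t 1) de).
move=> h; apply: (is_derive_eq h).
by rewrite /gam /cst /GRing.scale /=; ring.
Qed.

Let lip_gam T : 0 < T -> lip_wrt T (path_modulus X Z) gam.
Proof.
move=> T0; have w0 := path_modulus_ge0 X Z.
by apply: lip_wrtD; [|apply: lip_wrtM; [|exact: lip_wrt_expRN]]; exact: lip_wrt_cst.
Qed.

(** Each gradient belongs to C(X t), by Kronecker weights, and a minimum along X - Z is a maximum
    along Z - X. *)
Let steepest t v j : argminC g (X t) (X t - Z t) v ->
  dotv (g j (X t)) (Z t - X t) <= dotv v (Z t - X t).
Proof.
move=> [_ hmin].
have : Defs.convC g (X t) (g j (X t)).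
  exists (fun i => (i == j)%:R); split; first by move=> i; exact: ler0n.
  split; first by rewrite (bigD1 j) //= eqxx big1 ?addr0 // => i /negPf ->.
  rewrite (bigD1 j) //= eqxx scale1r big1 ?addr0 // => i /negPf ->.
  by rewrite scale0r.
move=> /hmin; rewrite -[X t - Z t]opprB !dotvNl lerN2.
by rewrite (dotvC v) (dotvC (g j _)).
Qed.

(** Strong convexity between [X t] and [z] gives the bound for each gradient; it survives averaging
    because the weights sum to 1. *)
Let convC_gap t v z : Defs.convC g (X t) v ->
  dotv v (z - X t) <= - gap f (X t) z - mu / 2 * enorm (z - X t) ^+ 2.
Proof.
move=> [lam [lam0 [lam1 ->]]].
have -> : dotv (\sum_j lam j *: g j (X t)) (z - X t) =
    \sum_j lam j * dotv (g j (X t)) (z - X t).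
  elim/big_rec2 : _ => [|i y1 y2 _ <-]; first by rewrite -(scale0r z) dotvZl mul0r.
  by rewrite dotvDl dotvZl.
rewrite -[leRHS]mul1r -[X in _ <= X * _]lam1 mulr_suml; apply: ler_sum => j _.
apply: ler_wpM2l => //.
have := fsc j (X t) z; have := gap_le f hm (X t) z j; lra.
Qed.

Lemma energy_decrease j T : 0 < T ->
  f j (X T) <= f j (X 0) + gamma0 / 2 * enorm (Z 0 - X 0) ^+ 2.
Proof.
move=> T0; have w0 := path_modulus_ge0 X Z.
pose phi t := f j (X t) + gam t * (2^-1 * dotv (Z t - X t) (Z t - X t)).
have -> : f j (X 0) + gamma0 / 2 * enorm (Z 0 - X 0) ^+ 2 = phi 0.
  by rewrite /phi enorm_sqr mulrA /gam oppr0 expR0 mulr1 [mu + _]addrC subrK.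
apply: (@le_trans _ _ (phi T)).
  by rewrite lerDl mulr_ge0 ?mulr_ge0 ?dotv_ge0 // ltW // gam_gt0.
have lipZX i : lip_wrt T (path_modulus X Z) (fun t => (Z t - X t) ord0 i).
  have -> : (fun t => (Z t - X t) ord0 i) =
      (fun t => Z t ord0 i + (-1) * X t ord0 i).
    by apply/funext => t; rewrite !mxE mulN1r.
  apply: lip_wrtD; first exact: lip_wrt_Z.
  by apply: lip_wrtM; [exact: lip_wrt_cst | exact: lip_wrt_X].
apply: (ac_nonincreasing T0 _ negN).
  apply: (lip_wrt_path_abs_cont hXac hZac T0); apply: lip_wrtD.
    exact: (lip_wrt_convex Z hXac T0 (Lj0 j) (gL j) (fcvx j)).
  apply: lip_wrtM; first exact: lip_gam.
  by apply: lip_wrtM; [exact: lip_wrt_cst | exact: lip_wrt_dotv].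
move=> t /andP[t0 _] Nt.
have [dX dZ X'E [v [vmin Z'E]]] := hode t0 Nt.
have hX := derivable_coord_derive dX; have hZ := derivable_coord_derive dZ.
have hW := coord_deriveB hZ hX.
have hphi := is_derive1D (is_derive_convex (gL j) (fcvx j) hX)
  (is_derive1M (is_derive_gam t)
    (is_derive1M (is_derive_cst (2^-1 : R) t 1) (is_derive_dotv hW hW))).
apply: (@is_derive_small_slope R T phi t _ hphi).
have := steepest j vmin.
have : gam t * dotv ('D_1 Z t) (Z t - X t) =
    dotv (mu *: (X t - Z t) - v) (Z t - X t) by rewrite -Z'E dotvZl.
rewrite X'E /cst mulr0 addr0.
rewrite -[X t - Z t]opprB.
(* After substituting the inclusion, the derivative is <g_j - v, W> - (mu + 3 gam)/2 |W|^2. *)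
set W := Z t - X t; clearbody W; rewrite !dotvE (dotvC W ('D_1 Z t)).
have : 0 <= gam t * dotv W W by rewrite mulr_ge0 ?dotv_ge0 // ltW // gam_gt0.
have : 0 <= mu * dotv W W by rewrite mulr_ge0 ?dotv_ge0.
move=> h1 h2 h3 h4; lra.
Qed.

Lemma lyapunov_decrease z T : 0 < T ->
  expR T * (gap f (X T) z + gam T / 2 * enorm (Z T - z) ^+ 2) <=
  gap f (X 0) z + gamma0 / 2 * enorm (Z 0 - z) ^+ 2.
Proof.
move=> T0; have w0 := path_modulus_ge0 X Z.
pose h t := gap f (X t) z.
pose q t := gam t * (2^-1 * dotv (Z t - z) (Z t - z)).
pose phi t := expR t * (h t + q t).
have -> : expR T * (gap f (X T) z + gam T / 2 * enorm (Z T - z) ^+ 2) = phi T.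
  by rewrite /phi /q enorm_sqr mulrA.
have -> : gap f (X 0) z + gamma0 / 2 * enorm (Z 0 - z) ^+ 2 = phi 0.
  by rewrite /phi /q enorm_sqr mulrA /gam oppr0 expR0 mulr1 [mu + _]addrC subrK mul1r.
have lipZ i : lip_wrt T (path_modulus X Z) (fun t => (Z t - z) ord0 i).
  have -> : (fun t => (Z t - z) ord0 i) = (fun t => Z t ord0 i + (- z ord0 i)).
    by apply/funext => t; rewrite !mxE.
  by apply: lip_wrtD; [exact: lip_wrt_Z | exact: lip_wrt_cst].
apply: (ac_nonincreasing T0 _ negN).
  apply: (lip_wrt_path_abs_cont hXac hZac T0); apply: lip_wrtM.
    exact: lip_wrt_expR.
  apply: lip_wrtD.
    apply: (@lip_wrt_min _ _ _ w0 _ (fun j t => f j (X t) - f j z)).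
    - move=> j; apply: lip_wrtD; last exact: lip_wrt_cst.
      exact: (lip_wrt_convex Z hXac T0 (Lj0 j) (gL j) (fcvx j)).
    - by move=> j t; exact: gap_le.
    - by move=> t; exact: gap_attained.
  apply: lip_wrtM; first exact: lip_gam.
  by apply: lip_wrtM; [exact: lip_wrt_cst | exact: lip_wrt_dotv].
move=> t /andP[t0 _] Nt.
have [dX dZ X'E [v [vmin Z'E]]] := hode t0 Nt.
have hX := derivable_coord_derive dX; have hZ := derivable_coord_derive dZ.
have hW := coord_deriveB hZ (coord_derive_cst z t).
(* [h] is replaced by its j-th piece, shifted to agree with [h] at [t], so that every [B j] is
   differentiable there and equals [phi t]. *)
pose B j s := expR s * ((f j (X s) + (h t - f j (X t))) + q s).
have Bt j : B j t = phi t by rewrite /B /phi; congr (_ * (_ + _)); ring.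
apply: (@small_slope_family _ _ _ _ _ B) => [j|s|s].
- have hB := is_derive1M (is_derive_expR t) (is_derive1D
    (is_derive1D (is_derive_convex (gL j) (fcvx j) hX)
                 (is_derive_cst (h t - f j (X t)) t 1))
    (is_derive1M (is_derive_gam t)
      (is_derive1M (is_derive_cst (2^-1 : R) t 1) (is_derive_dotv hW hW)))).
  apply: (@is_derive_small_slope R T (B j) t _ hB).
  rewrite (mulrC _ (expR t)) -mulrDr; apply: mulr_ge0_le0; first exact: expR_ge0.
  have := steepest j vmin.
  have := convC_gap z vmin.1.
  have : gam t * dotv ('D_1 Z t) (Z t - z) =
    dotv (mu *: (X t - Z t) - v) (Z t - z) by rewrite -Z'E dotvZl.
  rewrite X'E /cst /q subr0 mulr0 !addr0.
  rewrite -/(h t) enorm_sqr.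
  (* With z - X = W - Y, [convC_gap] cancels [h t] and the terms in |Y|^2 and <W,Y>; at most <g_j -
     v, W> - mu/2 |W|^2 remains, times e^t. *)
  set W := Z t - X t; set Y := Z t - z.
  have -> : X t - Z t = - W by rewrite opprB.
  have -> : z - X t = W - Y by apply/rowP => i; rewrite !mxE; ring.
  clearbody W Y; rewrite !dotvE (dotvC Y W) (dotvC Y ('D_1 Z t)).
  have : 0 <= mu * dotv W W by rewrite mulr_ge0 ?dotv_ge0.
  move=> h1 h2 h3 h4; lra.
(* The shift [h t - f j (X t)] is at most [- f j z], with equality for a piece active at [t]. *)
- have [j hj] := gap_attained f hm (X t) z; exists j.
  rewrite Bt lerD2r; apply: ler_wpM2l; first exact: expR_ge0.
  rewrite lerD2r /h; have := gap_le f hm (X s) z j; lra.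
- have [j hj] := gap_attained f hm (X s) z; exists j.
  rewrite Bt lerD2l lerN2; apply: ler_wpM2l; first exact: expR_ge0.
  rewrite lerD2r /h; have := gap_le f hm (X t) z j; lra.
Qed.

End Flow.

(** * Finiteness of S(alpha) and points of nearly minimal norm *)

Section MinimalNorm.
Variables (R : realType) (m n : nat) (f : 'I_m -> 'rV[R]_n -> R) (alpha : 'I_m -> R).

(** A weak Pareto point below [x] makes the supremum range over a nonempty set, hence nonnegative;
    the bounded sublevel set of [f j0] at [alpha j0] bounds it above. *)
Lemma Sfun_fin x : A2 f -> A3 f -> (forall j, f j x <= alpha j) ->
  exists2 s : R, 0 <= s & Sfun f alpha = s%:E.
Proof.
move=> [j0 hj0] hA3 xa.
have [M hM] := hj0 (alpha j0).
have [xs [wxs xsx]] := hA3 x.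
have xsa j : f j xs <= alpha j by exact: le_trans (xa j).
have S0 : (0 <= Sfun f alpha)%E.
  apply: le_ereal_sup_tmp.
  exists (ereal_inf [set (enorm z)%:E | z in [set z | forall j, f j z = f j xs]]).
    by exists xs.
  by apply: le_ereal_inf_tmp => _ [z _ <-]; rewrite lee_fin enorm_ge0.
have SM : (Sfun f alpha <= M%:E)%E.
  apply: ge_ereal_sup => _ [y [_ ya] <-]; apply: ge_ereal_inf.
  by exists (enorm y)%:E; [exists y | rewrite lee_fin; exact: hM].
have Sfin : Sfun f alpha \is a fin_num.
  by rewrite ge0_fin_numE //; apply: le_lt_trans SM _; exact: ltry.
exists (fine (Sfun f alpha)); first exact: fine_ge0.
by rewrite fineK.
Qed.

(** If every point with the values of [xs] had norm at least [s + eta], so would their infimum, and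
    S(alpha) would exceed [s]. *)
Lemma near_minimal_norm (s : R) xs eta : Sfun f alpha = s%:E ->
  weak_pareto f xs -> (forall j, f j xs <= alpha j) -> 0 < eta ->
  exists z, (forall j, f j z = f j xs) /\ enorm z < s + eta.
Proof.
move=> Ss wxs xsa eta0; apply: contrapT => none.
suff : ((s + eta)%:E <= Sfun f alpha)%E by rewrite Ss lee_fin gerDl leNgt eta0.
apply: le_ereal_sup_tmp.
exists (ereal_inf [set (enorm z)%:E | z in [set z | forall j, f j z = f j xs]]).
  by exists xs.
apply: le_ereal_inf_tmp => _ [z hz <-]; rewrite lee_fin leNgt.
by apply/negP => zs; apply: none; exists z.
Qed.

End MinimalNorm.

(** * Exponential decay of the merit function *)

Theorem mainTheorem8 (R : realType) (m n : nat)
  (f : 'I_m -> 'rV[R]_n -> R) (g : 'I_m -> 'rV[R]_n -> 'rV[R]_n)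
  (muj Lj : 'I_m -> R) (mu : R)
  (hm : (0 < m)%N)
  (hA1 : A1 f g muj Lj) (hA2 : A2 f) (hA3 : A3 f)
  (hmu : (exists j, mu = muj j) /\ (forall j, mu <= muj j))
  (gamma0 : R) (x0 x1 : 'rV[R]_n) (X Z : R -> 'rV[R]_n)
  (hgamma0 : 0 < gamma0)
  (hXac : loc_abs_cont X) (hZac : loc_abs_cont Z)
  (hX0 : X 0 = x0) (hZ0 : Z 0 = x0 + x1)
  (hode : exists N : set R, (@lebesgue_measure R).-negligible N /\
     forall t : R, 0 < t -> ~ N t ->
       [/\ derivable X t 1, derivable Z t 1,
           'D_1 X t = Z t - X t
         & exists v, argminC g (X t) (X t - Z t) v /\
             (mu + (gamma0 - mu) * expR (- t)) *: 'D_1 Z t = mu *: (X t - Z t) - v]) :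
  let alpha := fun j => f j x0 + gamma0 / 2 * enorm x1 ^+ 2 in
  (Sfun f alpha < +oo)%E /\
  forall t : R, 0 < t ->
    (u0 f (X t) <= (expR (- t))%:E *
       (u0 f x0 + (gamma0 * enorm (x0 + x1) ^+ 2)%:E + gamma0%:E * (Sfun f alpha * Sfun f alpha)))%E.
Proof.
move=> alpha.
have [N [negN ode]] := hode.
have mu0 : 0 <= mu.
  by have [[j ->] _] := hmu; have [_ _ _ _ /andP[]] := hA1 j.
have L0 j : 0 <= Lj j.
  by have [_ _ _ _ /andP[h1 h2]] := hA1 j; exact: le_trans h2.
have gL j : lipschitz_with (Lj j) (g j) by have [] := hA1 j.
have fsc j : strongly_convex_with mu (f j) (g j).
  have [_ _ _ h _] := hA1 j; move=> y z; apply: le_trans (h y z).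
  rewrite lerD2l ler_wpM2r ?sqr_ge0 // ler_pM2r ?invr_gt0 //.
  exact: hmu.2.
have Xalpha t : 0 < t -> forall j, f j (X t) <= alpha j.
  move=> t0 j.
  have := energy_decrease mu0 hgamma0 L0 gL fsc hXac hZac negN ode j t0.
  by rewrite hX0 hZ0 [x0 + x1]addrC addrK.
have x0alpha j : f j x0 <= alpha j.
  by rewrite lerDl mulr_ge0 ?sqr_ge0 // divr_ge0 // ltW.
have [s s0 Ss] := Sfun_fin hA2 hA3 x0alpha.
split; first by rewrite Ss ltry.
move=> t t0; rewrite Ss.
have u0_ge0 : (0 <= u0 f x0)%E.
  apply: le_ereal_sup_tmp; exists (fxz f x0 x0); first by exists x0.
  by rewrite (gapE f hm) lee_fin; have [j ->] := gap_attained f hm x0 x0; rewrite subrr.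
(* [u0 f x0] may be infinite; the right-hand side is then infinite too, as e^-t > 0. *)
have [u0oo|u0fin] := eqVneq (u0 f x0) +oo%E.
  by rewrite u0oo -!EFinM !addye // gt0_muley ?lte_fin ?expR_gt0 // leey.
have {u0fin} [r ur] : exists r : R, u0 f x0 = r%:E.
  exists (fine (u0 f x0)); rewrite fineK // ge0_fin_numE //.
  by rewrite ltey.
rewrite ur in u0_ge0 *; rewrite lee_fin in u0_ge0.
rewrite -!EFinM.
apply: ge_ereal_sup => _ [z _ <-]; rewrite (gapE f hm) lee_fin.
set A := gamma0 * enorm (x0 + x1) ^+ 2.
have A0 : 0 <= A by rewrite mulr_ge0 ?sqr_ge0 // ltW.
have S0 : 0 <= gamma0 * (s * s) by rewrite !mulr_ge0 // ltW.
have [gap0|gap0] := leP (gap f (X t) z) 0.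
  by apply: (le_trans gap0); rewrite mulr_ge0 ?expR_ge0 // !addr_ge0.
have [zs [wzs zsz]] := hA3 z.
(* F(zs) <= F(z) <= F(X t) <= alpha, the middle inequality because the gap is positive. *)
have zsa j : f j zs <= alpha j.
  apply: (le_trans (zsz j)); apply: le_trans (Xalpha t t0 j).
  by rewrite -subr_ge0; apply: (le_trans (ltW gap0)); exact: gap_le.
(* The infimum defining S(alpha) need not be attained, hence the slack eta. *)
have bound eta : 0 < eta ->
    expR t * gap f (X t) z <= r + A + gamma0 * (s + eta) ^+ 2.
  move=> eta0; have [z' [z'E z's]] := near_minimal_norm Ss wzs zsa eta0.
  have gap_zz' : gap f (X t) z <= gap f (X t) z'.
    have [j ->] := gap_attained f hm (X t) z'; rewrite z'E.
    by apply: (le_trans (gap_le f hm _ _ j)); rewrite lerD2l lerN2.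
  have gap_r : gap f x0 z' <= r.
    rewrite -lee_fin -ur -(gapE f hm); apply: ereal_sup_ubound; by exists z'.
  have gam_ge0 : 0 <= mu + (gamma0 - mu) * expR (- t).
    have e1 : expR (- t) <= 1 by rewrite -expR0 ler_expR oppr_le0 ltW.
    have := mulr_ge0 mu0 (_ : 0 <= 1 - expR (- t)); rewrite subr_ge0 => /(_ e1).
    have := mulr_ge0 (ltW hgamma0) (expR_ge0 (- t)); lra.
  have := lyapunov_decrease hm mu0 L0 gL fsc hXac hZac negN ode z' t0.
  rewrite hX0 hZ0 => lyap.
  apply: (@le_trans _ _ (gap f x0 z' + gamma0 / 2 * enorm (x0 + x1 - z') ^+ 2)).
    apply: le_trans lyap; rewrite ler_wpM2l ?expR_ge0 //.
    by apply: (le_trans gap_zz'); rewrite lerDl mulr_ge0 ?sqr_ge0 // divr_ge0.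
  have z'2 : enorm z' ^+ 2 <= (s + eta) ^+ 2.
    by rewrite ler_pXn2r // ?nnegrE ?enorm_ge0 ?addr_ge0 // ltW.
  have := ler_wpM2l (ltW hgamma0) z'2.
  have := ler_wpM2l (ltW hgamma0) (enormB_sqr_le (x0 + x1) z').
  rewrite /A; lra.
have -> : gap f (X t) z = expR (- t) * (expR t * gap f (X t) z).
  by rewrite mulrA -expRD addNr expR0 mul1r.
rewrite ler_wpM2l ?expR_ge0 //; apply/ler_addgt0Pr => e e0.
(* For eta <= 1, replacing [s] by [s + eta] costs gamma0 (2 s eta + eta^2) <= c eta, which the
   choice of [eta] keeps below [e]. *)
pose c := gamma0 * (2 * s + 1).
have c0 : 0 < c by rewrite mulr_gt0 // ltr_wpDl // mulr_ge0.
pose eta := Num.min 1 (e / c).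
have eta0 : 0 < eta by rewrite lt_min ltr01 divr_gt0.
apply: (le_trans (bound eta eta0)).
have eta1 : eta <= 1 by rewrite ge_min lexx.
have etac : c * eta <= e by rewrite mulrC -ler_pdivlMr // ge_min lexx orbT.
have := ler_wpM2l (ltW hgamma0) (ler_wpM2l (ltW eta0) eta1).
move: etac; rewrite /c; lra.
Qed.
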